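(* Let $G=(V,E)$ be a graph with $n$ vertices and $S$ a $(\kappa,\tau)$-regular subset of $V$ with cardinality $n_1$, and suppose that there exists a vertex $v\in S^c$ with no neighbors in $S^c$. Then $$S_L(G)\ \ge\ \frac{\tau(n-n_1)}{n_1}.$$ If equality holds, then there exists an integer $s$ such that $d_{S^c}(v)=s$ for all $v\in S$ and $sn_1=\tau(n-n_1)$, with $\mu_1=\frac{\tau n}{n_1}$ and $a(G)=\tau$.
   Context: Graphs are finite, simple and undirected. For a graph $G$ with $n$ vertices, $L(G)=D(G)-A(G)$ is the Laplacian matrix ($D(G)$ the diagonal matrix of vertex degrees, $A(G)$ the adjacency matrix), with eigenvalues $\mu_1\ge\dots\ge\mu_{n-1}\ge\mu_n=0$. The algebraic connectivity is $a(G)=\mu_{n-1}$ and the Laplacian spread is $S_L(G)=\mu_1-a(G)$. For $Y\subseteq V$, $Y^c=V\setminus Y$ and $d_Y(v)$ is the number of neighbors of $v$ in $Y$. A nonempty proper subset $S$ of $V$ is $(\kappa,\tau)$-regular if the subgraph induced by $S$ is $\kappa$-regular and every vertex in $S^c$ has exactly $\tau$ neighbors in $S$.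
   Formalization: The graph G is additionally assumed not to be complete: for G = K_n (n ≥ 2) the hypotheses force S to be V minus one vertex, and then S_L(G) = 0 while τ(n−n_1)/n_1 = 1, so the stated inequality always fails there. *)

(* Defs.v *)
From HB Require Import structures.
From mathcomp Require Import all_boot all_order all_algebra.
From mathcomp Require Import spectral complex polyrcf.

Set Implicit Arguments.
Unset Strict Implicit.
Unset Printing Implicit Defensive.

Import Order.TTheory GRing.Theory Num.Theory.
Local Open Scope ring_scope.

(* A finite simple undirected graph on V is a symmetric irreflexive e : rel V. *)
Section Graph.

Variables (V : finType) (e : rel V).

Definition nbrs_in (Y : {set V}) (v : V) : nat := #|[set w in Y | e v w]|.

Definition deg (v : V) : nat := #|[set w | e v w]|.

Definition complete_graph : Prop := forall x y : V, x != y -> e x y.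

(* The subgraph induced by S is kappa-regular when each vertex of S has
   exactly kappa neighbours in S. *)
Definition regular_subset (kappa tau : nat) (S : {set V}) : Prop :=
  [/\ S != set0,
      S \proper [set: V],
      forall v, v \in S -> nbrs_in S v = kappa &
      forall v, v \in ~: S -> nbrs_in S v = tau].

End Graph.

(* The real eigenvalues of A, repeated according to their algebraic
   multiplicity, in nonincreasing order.  eigenvalues_char_poly and
   size_eigenvalues below show that none is missing when A is symmetric. *)
Definition eigenvalues (R : rcfType) n (A : 'M[R]_n) : seq R :=
  let p := char_poly A in
  sort >=%R (flatten [seq nseq (mup x p) x | x <- rootsR p]).

Section Laplacian.

Variables (R : rcfType) (V : finType) (e : rel V).

Definition adjacency : 'M[R]_#|V| :=
  \matrix_(i, j) (e (enum_val i) (enum_val j))%:R.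

Definition degree_mx : 'M[R]_#|V| :=
  diag_mx (\row_i (deg e (enum_val i))%:R).

Definition laplacian : 'M[R]_#|V| := degree_mx - adjacency.

(* Numbered from 1 to #|V|; mu 1 is the largest. *)
Definition mu (k : nat) : R := nth 0 (eigenvalues laplacian) k.-1.

(* Meaningful for #|V| >= 2 only. *)
Definition alg_connectivity : R := mu #|V|.-1.

Definition laplacian_spread : R := mu 1 - alg_connectivity.

End Laplacian.

Section EigenvaluesTheory.

Variable R : rcfType.

Lemma char_poly_conj (F : fieldType) n (P D : 'M[F]_n) :
  P \in unitmx -> char_poly (invmx P *m D *m P) = char_poly D.
Proof.
move=> Pu; pose g := map_mx (@polyC F) : 'M[F]_n -> 'M_n.
have PVP : g (invmx P) *m g P = 1%:M by rewrite -map_mxM mulVmx // map_mx1.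
rewrite /char_poly.
have -> : char_poly_mx (invmx P *m D *m P) = g (invmx P) *m char_poly_mx D *m g P.
  rewrite /char_poly_mx !map_mxM mulmxBr mulmxBl; congr (_ - _).
  by rewrite -mulmxA mul_scalar_mx -scalemxAr PVP scalemx1.
by rewrite !det_mulmx mulrAC -det_mulmx PVP det1 mul1r.
Qed.

Lemma perm_flatten_mup (p : {poly R}) (s : seq R) :
  p = \prod_(x <- s) ('X - x%:P) ->
  perm_eq (flatten [seq nseq (mup x p) x | x <- rootsR p]) s.
Proof.
move=> ps; have p0 : p != 0 by rewrite ps monic_neq0 ?monic_prod_XsubC.
apply/permP => a; rewrite count_flatten.
rewrite -map_comp sumnE big_map /=.
transitivity (\sum_(x <- rootsR p) a x * count_mem x s)%N.
  by apply: eq_bigr => x _ /=; rewrite count_nseq ps mu_prod_XsubC.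
have urp : uniq (rootsR p) by exact: uniq_roots.
have sub y : y \in s -> y \in rootsR p.
  move=> ys; have /(_ y) := roots_on_rootsR p0.
  by rewrite in_itv /= => <-; rewrite ps root_prod_XsubC.
transitivity (\sum_(x <- rootsR p) \sum_(y <- s) a y * (y == x))%N.
  apply: eq_bigr => x _; rewrite -sum1_count big_distrr big_mkcond /=.
  by apply: eq_bigr => y _; case: eqP => [->|]; rewrite ?muln0.
rewrite exchange_big /= -sum1_count [RHS]big_mkcond /=.
rewrite big_seq [RHS]big_seq; apply: eq_bigr => y ys.
rewrite -big_distrr /= (bigD1_seq y) ?sub //= eqxx big1 ?addn0 ?muln1.
  by case: (a y).
by move=> z; rewrite eq_sym => /negbTE ->.
Qed.

Lemma symmetric_char_poly_split n (A : 'M[R]_n) :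
  A^T = A -> exists s : seq R, char_poly A = \prod_(x <- s) ('X - x%:P).
Proof.
move=> Asym; pose f := real_complex R; pose B := map_mx f A.
have Breal : B \is a mxOver Num.real.
  by apply/mxOverP => i j; rewrite mxE complex_real.
have Bherm : B \is hermsymmx.
  apply: realsym_hermsym Breal; apply/is_hermitianmxP.
  rewrite expr0 scale1r map_mx_id //.
  by apply/matrixP => i j; rewrite !mxE -[in LHS]Asym mxE.
have dreal := hermitian_spectral_diag_real Bherm.
have /orthomx_spectralP Beq := hermitian_normalmx Bherm.
set P := spectralmx B in Beq; set d := spectral_diag B in Beq dreal.
exists [seq complex.Re (d 0 i) | i <- enum 'I_n].
apply: (map_poly_inj f); rewrite map_char_poly -/B big_map rmorph_prod /=.
have -> : char_poly B = char_poly (diag_mx d).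
  by rewrite [in LHS]Beq char_poly_conj ?spectral_unit.
rewrite char_poly_trig ?diag_mx_is_trig // big_enum /=.
apply: eq_bigr => i _; rewrite rmorphB /= map_polyX map_polyC /= mxE eqxx mulr1n.
by rewrite RRe_real // (mxOverP dreal).
Qed.

Lemma eigenvalues_char_poly n (A : 'M[R]_n) :
  A^T = A -> char_poly A = \prod_(x <- eigenvalues A) ('X - x%:P).
Proof.
move=> /symmetric_char_poly_split [s ps].
rewrite [LHS]ps; apply/esym/perm_big; rewrite perm_sort.
exact: perm_flatten_mup.
Qed.

Lemma size_eigenvalues n (A : 'M[R]_n) : A^T = A -> size (eigenvalues A) = n.
Proof.
move=> Asym; apply: succn_inj; rewrite -(size_char_poly A).
by rewrite (eigenvalues_char_poly Asym) size_prod_XsubC.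
Qed.

Lemma sorted_eigenvalues n (A : 'M[R]_n) : sorted >=%R (eigenvalues A).
Proof. by apply: sort_sorted => x y; exact: le_total. Qed.

Lemma laplacian_tr (V : finType) (e : rel V) :
  symmetric e -> (laplacian R e)^T = laplacian R e.
Proof.
move=> e_sym; apply/matrixP => i j; rewrite !mxE e_sym eq_sym.
by case: eqP => // ->.
Qed.

End EigenvaluesTheory.

(* Main.v *)
Require Import Defs.
From HB Require Import structures.
From mathcomp Require Import all_boot all_order all_algebra.
From mathcomp Require Import spectral complex zify ring lra.

(** The spread is bounded below by bounding [mu 1] from below and the algebraic
    connectivity from above, each time by a Rayleigh quotient.

    - Let [n1] be the cardinality of [S], and let [g] be [n - n1] on [S] and
      [- n1] off [S], that is, [n] times the indicator function of [S], shifted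
      to have sum zero.  The edges between [S] and its complement are counted
      by [tau * (n - n1)], so the Rayleigh quotient of [g] is [tau * n / n1], a
      lower bound for [mu 1] ([mu1_rayleigh]).
    - The vertex [v] without neighbours outside [S] has degree [tau].  In a
      noncomplete graph the algebraic connectivity is at most every vertex
      degree ([alg_connectivity_le_deg], a weak form of Fiedler's bound by the
      vertex connectivity), hence at most [tau].

    The difference of the two bounds is [tau * (n - n1) / n1].  When the spread
    equals it, both bounds are attained; the maximum of the Rayleigh quotient
    is attained only at eigenvectors, so [g] is one for [mu 1], and the
    eigenvalue equation at a vertex of [S] reads
    [n * d = tau * n / n1 * (n - n1)], where [d] is its number of neighbours
    outside [S].  Hence [d] is constant on [S].

    The two variational facts ([rayleigh_max], [rayleigh_second_smallest])
    come from the coordinates of a real vector in a complex orthonormal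
    eigenbasis ([spectral_coordinates]). *)

Import Order.TTheory GRing.Theory Num.Theory.
Local Open Scope ring_scope.

Set Implicit Arguments.
Unset Strict Implicit.
Unset Printing Implicit Defensive.

(** * Rayleigh quotients of real symmetric matrices *)

Section Rayleigh.

Variables (R : rcfType) (n : nat).
Implicit Types (A : 'M[R]_n) (x y z : 'rV[R]_n).

Definition dot x y : R := (x *m y^T) 0 0.

Lemma dotE x y : dot x y = \sum_i x 0 i * y 0 i.
Proof. by rewrite /dot mxE; apply: eq_bigr => i _; rewrite mxE. Qed.

Lemma dot_eq0 x : dot x x = 0 -> x = 0.
Proof.
rewrite dotE => /eqP; rewrite psumr_eq0 => [/allP x0|i _]; last exact: sqr_ge0.
apply/rowP => i; apply/eqP; rewrite mxE -(orbb (x 0 i == 0)) -mulf_eq0.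
exact: x0 (mem_index_enum i).
Qed.

(** Complexifying makes the unitary diagonalisation of Hermitian matrices
    available; since the eigenvalues are real, complex coordinates serve as
    well as real ones for comparing quadratic forms over the reals. *)
Lemma spectral_coordinates A : A^T = A ->
  exists (u : 'rV[R]_n -> 'rV[R[i]]_n) (d : 'I_n -> R),
    [/\ forall x y, (dot x y)%:C%C = \sum_i u x 0 i * (u y 0 i)^*,
        forall x i, u (x *m A) 0 i = (d i)%:C%C * u x 0 i &
        perm_eq [seq d i | i <- enum 'I_n] (eigenvalues A)].
Proof.
move=> Asym; pose f := real_complex R; pose B := map_mx f A.
have Bherm : B \is hermsymmx.
  apply: realsym_hermsym; last first.
    by apply/mxOverP => i j; rewrite mxE complex_real.
  apply/is_hermitianmxP; rewrite expr0 scale1r map_mx_id //.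
  by apply/matrixP => i j; rewrite !mxE -[in LHS]Asym mxE.
have dreal := hermitian_spectral_diag_real Bherm.
have /orthomx_spectralP Beq := hermitian_normalmx Bherm.
have PU := spectral_unitarymx B.
set P := spectralmx B in Beq PU; set D := spectral_diag B in Beq dreal.
pose Pt := (P ^t (@Num.conj (R[i] : numClosedFieldType)))%sesqui.
have PV : invmx P = Pt by rewrite invmx_unitary.
have PtP : Pt *m P = 1%:M by rewrite -PV mulVmx // unitarymx_unit.
have PPt : P *m Pt = 1%:M by rewrite -PV mulmxV // unitarymx_unit.
pose d i := complex.Re (D 0 i).
have dE i : (d i)%:C%C = D 0 i by rewrite RRe_real // (mxOverP dreal).
(* The rows of [P] are the eigenvectors. *)
exists (fun x => map_mx f x *m Pt), d; split.
- move=> x y.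
  transitivity ((map_mx f x *m Pt *m (P *m map_mx f y^T)) 0 0).
    rewrite mulmxA -(mulmxA _ Pt) PtP mulmx1 -map_mxM mxE //.
  rewrite mxE; apply: eq_bigr => i _; congr (_ * _).
  rewrite !mxE rmorph_sum; apply: eq_bigr => j _.
  rewrite !mxE rmorphM /= mulrC; congr (_ * _); last by rewrite conjCK.
  by apply/esym/CrealP; rewrite complex_real.
- move=> x i; rewrite map_mxM -/B Beq PV.
  have -> : map_mx f x *m (Pt *m diag_mx D *m P) *m Pt
            = map_mx f x *m Pt *m diag_mx D.
    by rewrite !mulmxA -[LHS]mulmxA PPt mulmx1.
  by rewrite mul_mx_diag mxE dE mulrC.
- rewrite perm_sym perm_sort perm_flatten_mup //.
  apply: (map_poly_inj f); rewrite map_char_poly -/B big_map rmorph_prod /=.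
  have -> : char_poly B = char_poly (diag_mx D).
    by rewrite [in LHS]Beq char_poly_conj ?spectral_unit.
  rewrite char_poly_trig ?diag_mx_is_trig // big_enum /=.
  apply: eq_bigr => i _; rewrite rmorphB /= map_polyX map_polyC /= mxE eqxx.
  by rewrite mulr1n -dE.
Qed.

Lemma dotBl x y z : dot (x - y) z = dot x z - dot y z.
Proof. by rewrite /dot mulmxBl !mxE. Qed.

Lemma dotZl a x y : dot (a *: x) y = a * dot x y.
Proof. by rewrite /dot -scalemxAl mxE. Qed.

Lemma eigenvalues_le_head A (t : R) :
  t \in eigenvalues A -> t <= (eigenvalues A)`_0.
Proof.
have := sorted_eigenvalues A; case: (eigenvalues A) => [|a s] //=.
rewrite (path_sortedE (rev_trans le_trans)) => /andP[/allP aP _].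
by rewrite inE => /predU1P[->|/aP].
Qed.

(** The list is nonincreasing, so only its last entry can be smaller than the
    one at index [n - 2].  For [n <= 1] truncation makes the index 0, and the
    bound still holds. *)
Lemma count_lt_second_smallest A : A^T = A ->
  (count (fun t => (t < (eigenvalues A)`_n.-2)%R) (eigenvalues A) <= 1)%N.
Proof.
move=> Asym; have sz := size_eigenvalues Asym.
set s := eigenvalues A in sz *.
rewrite -{2}(cat_take_drop n.-1 s) count_cat.
rewrite (_ : count _ (take _ _) = 0%N) ?add0n; last first.
  apply/eqP; rewrite eqn0Ngt -has_count; apply/hasPn => t.
  move=> /(nthP 0)[k]; rewrite size_take_min leq_min => /andP[kn ks] <-.
  rewrite nth_take // -leNgt.
  apply: (sorted_leq_nth (rev_trans le_trans) lexx 0 (sorted_eigenvalues A)).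
  - by rewrite inE.
  - by rewrite inE -/s sz; lia.
  - by lia.
by apply: leq_trans (count_size _ _) _; rewrite size_drop sz; lia.
Qed.

(** In eigencoordinates the gap between the two sides is a sum of terms
    [(m - d i) * `|u i| ^ 2], all nonnegative.  If it vanishes, each term does,
    so every coordinate of [x] with eigenvalue other than [m] is zero. *)
Lemma rayleigh_max A x : A^T = A ->
  dot (x *m A) x <= (eigenvalues A)`_0 * dot x x ?= iff
    (x *m A == (eigenvalues A)`_0 *: x).
Proof.
move=> Asym; have [u [d [dotu uA perm_d]]] := spectral_coordinates Asym.
set m := _`_0.
have dm i : d i <= m.
  by rewrite eigenvalues_le_head // -(perm_mem perm_d) map_f ?mem_enum.
have gapE y : (m * dot x y - dot (x *m A) y)%:C%C =
    \sum_i (m - d i)%:C%C * (u x 0 i * (u y 0 i)^*).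
  rewrite rmorphB rmorphM /= !dotu big_distrr -sumrB; apply: eq_bigr => i _ /=.
  by rewrite uA rmorphB /=; ring.
have gap_ge0 i : 0 <= (m - d i)%:C%C * (u x 0 i * (u x 0 i)^*).
  by rewrite mulr_ge0 ?mul_conjC_ge0 // ler0c subr_ge0.
split; first by rewrite -subr_ge0 -ler0c gapE sumr_ge0.
apply/eqP/eqP => [eq_m|->]; last by rewrite dotZl.
apply/eqP; rewrite -subr_eq0; apply/eqP/dot_eq0; set y := _ - _.
apply/eqP; rewrite /y dotBl dotZl -/y subr_eq0 eq_sym -subr_eq0.
rewrite -(inj_eq (@complexI R)) gapE; apply/eqP/big1 => i _.
have := gapE x; rewrite eq_m subrr => /esym/eqP.
rewrite psumr_eq0 // => /allP/(_ i (mem_index_enum i)).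
by rewrite mulf_eq0 mul_conjC_eq0 => /orP[]/eqP->; rewrite ?mul0r ?mulr0.
Qed.

(** This is the variational characterisation of the second smallest eigenvalue
    [a], for a matrix whose smallest eigenvalue is 0 with a known eigenvector
    [z].  When [a <= 0], it is positivity of the form.  When [0 < a], at most
    one eigenvalue is below [a]; the nonzero kernel vector [z] must then lie
    along that single eigenvector, so [x], being orthogonal to [z], has no
    component there. *)
Lemma rayleigh_second_smallest A x z : A^T = A ->
    (forall y, 0 <= dot (y *m A) y) -> z != 0 -> z *m A = 0 -> dot x z = 0 ->
  (eigenvalues A)`_n.-2 * dot x x <= dot (x *m A) x.
Proof.
move=> Asym psdA z_neq0 zA xz.
have [u [d [dotu uA perm_d]]] := spectral_coordinates Asym.
have := count_lt_second_smallest Asym; set a := _`_ _ => few_lt_a.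
have [a_le0|a_gt0] := lerP a 0.
  apply: le_trans (psdA x); rewrite mulr_le0_ge0 // dotE sumr_ge0 // => i _.
  exact: sqr_ge0.
have lt_a_uniq i j : d i < a -> d j < a -> i = j.
  have /card_le1_eqP : (#|[pred i | (d i < a)%R]| <= 1)%N.
    apply: leq_trans few_lt_a; rewrite -(permP perm_d) count_map.
    rewrite cardE /enum_mem size_filter count_filter.
    by apply: sub_count => k /= dk; rewrite andbT.
  by move=> le1 dia dja; apply: (le1 j i).
have uz j : d j != 0 -> u z 0 j = 0.
  have /esym/eqP := dotu (z *m A) (z *m A).
  rewrite zA /dot mul0mx mxE psumr_eq0 => [/allP/(_ j)|i _]; last first.
    exact: mul_conjC_ge0.
  rewrite mem_index_enum -zA mul_conjC_eq0 uA mulf_eq0 => /(_ isT).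
  by rewrite (inj_eq (@complexI R) _ 0) => /orP[/eqP->|/eqP//]; rewrite eqxx.
have ux0 i : d i < a -> u x 0 i = 0.
  move=> dia; have uz0 j : j != i -> u z 0 j = 0.
    move=> ji; apply/uz/lt0r_neq0/(lt_le_trans a_gt0); rewrite leNgt.
    by apply: contra ji => dja; rewrite (lt_a_uniq j i).
  have dotz y : (dot y z)%:C%C = u y 0 i * (u z 0 i)^*.
    by rewrite dotu (bigD1 i) //= big1 ?addr0 // => j /uz0->;
      rewrite conjC0 mulr0.
  have /eqP := dotz x; rewrite xz eq_sym mulf_eq0 conjC_eq0.
  move=> /orP[/eqP//|/eqP uzi].
  move: z_neq0; have := dotz z; rewrite uzi mul0r => /complexI /dot_eq0 ->.
  by rewrite eqxx.
rewrite -subr_ge0 -ler0c rmorphB rmorphM /= !dotu big_distrr -sumrB sumr_ge0 //.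
move=> i _ /=; rewrite uA.
have [/ux0 ux|adi] := ltrP (d i) a; first by rewrite ux !(mulr0, mul0r) subr0.
rewrite -mulrA -mulrBl -rmorphB mulr_ge0 ?mul_conjC_ge0 //.
by rewrite ler0c subr_ge0.
Qed.

End Rayleigh.

(** * Laplacians acting on functions on the vertices *)

Section LaplacianForm.

Variables (R : rcfType) (V : finType) (e : rel V).
Hypotheses (e_sym : symmetric e) (e_irr : irreflexive e).
Implicit Types (g h : V -> R) (v w : V) (Y : {set V}).

Definition vec g : 'rV[R]_#|V| := \row_i g (enum_val i).

(** The Laplacian matrix as an operator on functions; the difference form makes
    it visible that constants are in the kernel. *)
Definition lap g v : R := \sum_w (e v w)%:R * (g v - g w).

Lemma sum_enum_val g : \sum_(i < #|V|) g (enum_val i) = \sum_v g v.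
Proof.
by rewrite [RHS](reindex (@enum_val V V)) //; apply/onW_bij/enum_val_bij.
Qed.

Lemma dot_vec g h : dot (vec g) (vec h) = \sum_v g v * h v.
Proof.
by rewrite dotE -sum_enum_val; apply: eq_bigr => i _; rewrite !mxE.
Qed.

Lemma nbrs_in_sum Y v : nbrs_in e Y v = (\sum_(w in Y) e v w)%N.
Proof.
rewrite /nbrs_in -sum1_card [RHS]big_mkcond [LHS]big_mkcond.
by apply: eq_bigr => w _; rewrite inE; case: (w \in Y); case: (e v w).
Qed.

Lemma deg_sum v : (deg e v)%:R = \sum_w (e v w)%:R :> R.
Proof.
rewrite -natr_sum /deg -sum1_card big_mkcond; congr _%:R.
by apply: eq_bigr => w _; rewrite inE; case: (e v w).
Qed.

Lemma vec_laplacian g : vec g *m laplacian R e = vec (lap g).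
Proof.
apply/rowP => j; rewrite !mxE /laplacian.
set v := enum_val j.
under eq_bigr => i _ do rewrite !mxE mulrBr.
rewrite sumrB (bigD1 j) //= eqxx mulr1n big1 ?addr0 => [|i ij]; last first.
  by rewrite (negbTE ij) mulr0n mulr0.
rewrite (sum_enum_val (fun w => g w * (e w v)%:R)) deg_sum big_distrr -sumrB /=.
by apply: eq_bigr => w _; rewrite e_sym -/v; ring.
Qed.

Lemma lap_energy g :
  2 * \sum_v lap g v * g v = \sum_v \sum_w (e v w)%:R * (g v - g w) ^+ 2.
Proof.
rewrite mulr_natl mulr2n {2}/lap.
under [X in _ + X]eq_bigr do rewrite big_distrl.
rewrite [X in _ + X]exchange_big -big_split; apply: eq_bigr => v _ /=.
rewrite big_distrl -big_split; apply: eq_bigr => w _ /=.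
by rewrite (e_sym w); ring.
Qed.

Lemma laplacian_psd (x : 'rV[R]_#|V|) : 0 <= dot (x *m laplacian R e) x.
Proof.
pose g v := x 0 (enum_rank v).
have -> : x = vec g by apply/rowP => i; rewrite !mxE /g enum_valK.
rewrite vec_laplacian dot_vec -(pmulr_rge0 _ (ltr0n _ 2)) lap_energy.
by do 2![apply: sumr_ge0 => ? _]; rewrite mulr_ge0 ?ler0n ?sqr_ge0.
Qed.

Lemma lap_const c v : lap (fun=> c) v = 0.
Proof. by rewrite /lap big1 // => w _; rewrite subrr mulr0. Qed.

Lemma mu1_rayleigh g :
  \sum_v lap g v * g v <= mu R e 1 * \sum_v g v ^+ 2 ?= iff
    [forall v, lap g v == mu R e 1 * g v].
Proof.
have := rayleigh_max (vec g) (laplacian_tr R e_sym).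
rewrite vec_laplacian !dot_vec /mu -/(_`_0); set m := _`_0.
under [X in _ * X]eq_bigr do rewrite -expr2.
congr (_ <= _ ?= iff _); apply/eqP/forallP => [/rowP gm v|gm].
  by have := gm (enum_rank v); rewrite !mxE enum_rankK => ->.
by apply/rowP => i; rewrite !mxE; apply/eqP.
Qed.

Lemma alg_connectivity_rayleigh g :
  \sum_v g v = 0 ->
  alg_connectivity R e * \sum_v g v ^+ 2 <= \sum_v lap g v * g v.
Proof.
move=> g0; have [v0 _|V0] := pickP V; last first.
  by rewrite !big1 ?mulr0 // => v; have := V0 v.
have z0 : vec (fun=> 1) != 0.
  by apply/eqP => /rowP/(_ (enum_rank v0)); rewrite !mxE; apply/eqP/oner_neq0.
have := rayleigh_second_smallest (x := vec g) (laplacian_tr R e_sym)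
          laplacian_psd z0.
rewrite !vec_laplacian !dot_vec; under [X in _ * X]eq_bigr do rewrite -expr2.
apply; first by apply/rowP => i; rewrite !mxE lap_const.
by under eq_bigr do rewrite mulr1.
Qed.

(** Removing the neighbours of [v] isolates [v] from the nonempty set [F] of its
    nonneighbours.  The test function is constant on each of these two sides,
    zero on the neighbours, and has sum zero.  Its Laplacian is at most
    [deg v] times it at [v], and at least that on [F] where it is negative, so
    the comparison with [deg v * g u ^+ 2] holds vertex by vertex. *)
Lemma alg_connectivity_le_deg_nonadjacent v w :
  w != v -> ~~ e v w -> alg_connectivity R e <= (deg e v)%:R.
Proof.
move=> wv evw; pose F := [set u | (u != v) && ~~ e v u].
have vF : v \notin F by rewrite inE eqxx.
pose m : R := #|F|%:R.
have m_gt0 : 0 < m by rewrite ltr0n; apply/card_gt0P; exists w; rewrite inE wv.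
pose g u : R := if u == v then m else if u \in F then -1 else 0.
have gF u : u \in F -> g u = -1.
  by move=> uF; rewrite /g uF; case: eqP => // uv; rewrite uv (negbTE vF) in uF.
have gN u : e v u -> g u = 0.
  move=> evu; rewrite /g !inE evu andbF; case: eqP => // uv.
  by rewrite uv e_irr in evu.
have gv : g v = m by rewrite /g eqxx.
have g_sum0 : \sum_u g u = 0.
  rewrite (bigD1 v) //= gv (eq_bigr (fun u => - (u \in F)%:R)) => [|u uv].
    rewrite sumrN -natr_sum /m; apply/eqP; rewrite subr_eq0 eqr_nat -sum1_card.
    by rewrite big_mkcond (bigD1 v) //= (negbTE vF).
  by rewrite /g (negbTE uv); case: ifP; rewrite ?oppr0.
have g_sq : 0 < \sum_u g u ^+ 2.
  rewrite (bigD1 v) //= gv ltr_pwDl ?exprn_gt0 // sumr_ge0 // => u _.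
  exact: sqr_ge0.
rewrite -(ler_pM2r g_sq); apply: le_trans (alg_connectivity_rayleigh g_sum0) _.
(* The inequality already holds for each vertex [u]. *)
rewrite big_distrr; apply: ler_sum => u _ /=.
have [->|uv] := eqVneq u v.
  rewrite gv expr2 mulrA ler_wpM2r ?(ltW m_gt0) // deg_sum big_distrl.
  rewrite ler_sum // => x _.
  by rewrite gv /=; case evx: (e v x); rewrite ?(gN _ evx) ?subr0 ?mul0r ?lexx.
have [uF|uF] := boolP (u \in F); last first.
  by rewrite /g (negbTE uv) (negbTE uF) expr2 !mulr0.
rewrite gF // sqrrN expr1n mulr1 mulrN1 /lap -sumrN deg_sum ler_sum // => x _.
rewrite gF //.
(* An edge from [u] contributes only if it ends at a neighbour of [v]: the
   function has the same value at both ends of an edge inside [F]. *)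
case eux: (e u x); rewrite ?mul0r ?oppr0 ?ler0n // mul1r opprB opprK.
case evx: (e v x); first by rewrite gN // add0r.
have xv : x != v.
  by apply: contraTneq uF => xv; rewrite inE e_sym -xv eux andbF.
by rewrite gF ?inE ?xv ?evx // addNr.
Qed.

(** A vertex [v] adjacent to all others has the largest possible degree, so the
    bound for it follows from the one at either end of a missing edge. *)
Lemma alg_connectivity_le_deg v :
  ~ complete_graph e -> alg_connectivity R e <= (deg e v)%:R.
Proof.
move=> e_ncomplete.
have [w /andP[]|v_all] := pickP [pred w | (w != v) && ~~ e v w].
  exact: alg_connectivity_le_deg_nonadjacent.
have [x [y [xy exy]]] : exists x y, x != y /\ ~~ e x y.
  have [/existsP[x /existsP[y /andP[]]]|] :=
    boolP [exists x, exists y, (x != y) && ~~ e x y]; first by exists x, y.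
  move=> /existsPn all_adj; case: e_ncomplete => x y xy.
  by have /existsPn/(_ y) := all_adj x; rewrite xy negbK.
rewrite eq_sym in xy.
apply: le_trans (alg_connectivity_le_deg_nonadjacent xy exy) _.
rewrite ler_nat /deg.
have -> : [set w | e v w] = [set~ v].
  apply/setP => w; rewrite !inE; have := v_all w; rewrite /=.
  by case: eqVneq => [->|_ /negbFE]; rewrite ?e_irr.
rewrite cardsC1 -(cardsC1 x) subset_leq_card //; apply/subsetP => w.
by rewrite !inE; apply: contraTneq => ->; rewrite e_irr.
Qed.

Lemma deg_nbrs_in Y v : deg e v = (nbrs_in e Y v + nbrs_in e (~: Y) v)%N.
Proof.
rewrite /deg /nbrs_in -(cardsID Y); congr (_ + _)%N; apply: eq_card => w;
  by rewrite !inE andbC.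
Qed.

(** Both sides count the ordered edges from [Y] to [Z]. *)
Lemma sum_nbrs_in_sym Y Z :
  (\sum_(v in Y) nbrs_in e Z v = \sum_(w in Z) nbrs_in e Y w)%N.
Proof.
under eq_bigr do rewrite nbrs_in_sum.
rewrite exchange_big; apply: eq_bigr => w _ /=; rewrite nbrs_in_sum.
by apply: eq_bigr => v _; rewrite e_sym.
Qed.

(** Multiplied by the number of vertices, so that the values are integers:
    [#|V| - #|Y|] on [Y] and [- #|Y|] off [Y]. *)
Definition centred_ind Y v : R := #|V|%:R * (v \in Y)%:R - #|Y|%:R.

Lemma lap_centred_ind Y v :
  lap (centred_ind Y) v =
    #|V|%:R * (if v \in Y then (nbrs_in e (~: Y) v)%:R
               else - (nbrs_in e Y v)%:R).
Proof.
rewrite /lap /centred_ind !nbrs_in_sum !natr_sum.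
rewrite [X in if _ then X else _]big_mkcond.
rewrite [X in if _ then _ else - X]big_mkcond -sumrN.
case: ifP => vY; rewrite big_distrr; apply: eq_bigr => w _ /=;
  by rewrite ?inE; case: (w \in Y) => /=; ring.
Qed.

End LaplacianForm.

(** * The Laplacian spread of a graph with a regular subset *)

Theorem corollary14 (R : rcfType) (V : finType) (e : rel V)
    (e_sym : symmetric e) (e_irr : irreflexive e)
    (e_ncomplete : ~ complete_graph e)
    (kappa tau : nat) (S : {set V}) (S_reg : regular_subset e kappa tau S)
    (v_ex : exists2 v : V, v \in ~: S & nbrs_in e (~: S) v = 0%N) :
  let n : R := #|V|%:R in
  let n1 : R := #|S|%:R in
  laplacian_spread R e >= tau%:R * (n - n1) / n1 /\
  (laplacian_spread R e = tau%:R * (n - n1) / n1 ->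
   (exists s : int,
      (forall v : V, v \in S -> (nbrs_in e (~: S) v)%:Z = s) /\
      s * #|S|%:Z = tau%:Z * (#|V|%:Z - #|S|%:Z)) /\
   mu R e 1 = tau%:R * n / n1 /\
   alg_connectivity R e = tau%:R).
Proof.
case: S_reg v_ex => S0 _ _ tauS [v0 v0S v0_isol] n n1.
have [s0 s0S] := set0Pn _ S0.
have n1_gt0 : 0 < n1 by rewrite ltr0n; apply/card_gt0P; exists s0.
have n1_lt : 0 < n - n1.
  rewrite subr_gt0 ltr_nat -(cardsC S) -[X in (X < _)%N]addn0 ltn_add2l.
  by apply/card_gt0P; exists v0.
have nE : n - n1 = #|~: S|%:R.
  by rewrite /n -(cardsC S) natrD addrAC subrr add0r.
have n1_neq0 := lt0r_neq0 n1_gt0.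
have a_le : alg_connectivity R e <= tau%:R.
  apply: le_trans (alg_connectivity_le_deg R e_sym e_irr v0 e_ncomplete) _.
  by rewrite (deg_nbrs_in _ S) v0_isol addn0 tauS.
pose g := centred_ind R S.
have gS v : v \in S -> g v = n - n1.
  by rewrite /g /centred_ind => ->; rewrite mulr1.
have gSC v : v \in ~: S -> g v = - n1.
  by rewrite inE /g /centred_ind => /negbTE->; rewrite mulr0 add0r.
have lapS v : v \in S -> lap e g v = n * (nbrs_in e (~: S) v)%:R.
  by move=> vS; rewrite lap_centred_ind vS.
have lapSC v : v \in ~: S -> lap e g v = - (n * tau%:R).
  move=> vS; have /negbTE vNS : v \notin S by rewrite -in_setC.
  by rewrite lap_centred_ind vNS tauS // mulrN.
have split_sum (F : V -> R) :
    \sum_v F v = \sum_(v in S) F v + \sum_(v in ~: S) F v.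
  by rewrite (bigID (mem S)) /=; congr (_ + _); apply: eq_bigl => v; rewrite inE.
have g_sq : \sum_v g v ^+ 2 = n * n1 * (n - n1).
  rewrite split_sum (eq_bigr (fun=> (n - n1) ^+ 2)) => [|v /gS-> //].
  rewrite [X in _ + X](eq_bigr (fun=> n1 ^+ 2)) => [|v /gSC->]; last by ring.
  rewrite !sumr_const -[_ *+ #|S|]mulr_natl -[_ *+ #|~: S|]mulr_natl.
  by rewrite -nE -/n1; ring.
have g_energy : \sum_v lap e g v * g v = tau%:R * n / n1 * \sum_v g v ^+ 2.
  rewrite g_sq split_sum.
  rewrite (eq_bigr (fun v => n * (n - n1) * (nbrs_in e (~: S) v)%:R)); last first.
    by move=> v vS; rewrite lapS // gS //; ring.
  rewrite -big_distrr -natr_sum /= sum_nbrs_in_sym // (eq_bigr (fun=> tau)) //.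
  rewrite [X in _ + X](eq_bigr (fun=> n * n1 * tau%:R)); last first.
    by move=> v vS; rewrite lapSC // gSC //; ring.
  rewrite sum_nat_const natrM sumr_const -[_ * tau%:R *+ _]mulr_natl -nE.
  by field.
have g_sq_gt0 : 0 < \sum_v g v ^+ 2.
  by rewrite g_sq !mulr_gt0 //; lra.
have [] := mu1_rayleigh e_sym g.
rewrite g_energy ler_pM2r // => mu_ge eq_mu.
have boundE : tau%:R * (n - n1) / n1 = tau%:R * n / n1 - tau%:R :> R by field.
rewrite boundE /laplacian_spread; split=> [|eq_spread]; first by lra.
have mu_eq : mu R e 1 = tau%:R * n / n1 by lra.
split; last by split=> //; lra.
have nbrsE v : v \in S -> (nbrs_in e (~: S) v * #|S| = tau * #|~: S|)%N.
  (* Equality in the Rayleigh bound: [g] is an eigenvector for [mu 1]. *)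
  move=> vS; move/esym: eq_mu; rewrite mu_eq eqxx => /forallP/(_ v)/eqP.
  rewrite lapS // gS // => /(congr1 ( *%R (n1 / n))) nbrs_eq.
  apply/eqP; rewrite -(eqr_nat R) !natrM -nE -/n1; apply/eqP.
  have n_neq0 : n != 0 by apply: lt0r_neq0; lra.
  transitivity (n1 / n * (n * (nbrs_in e (~: S) v)%:R)); first by field.
  by rewrite nbrs_eq; field; rewrite n1_neq0.
exists (nbrs_in e (~: S) s0)%:Z; split=> [v vS|].
  congr Posz; apply/eqP; rewrite -(eqn_pmul2r (_ : 0 < #|S|)%N) ?nbrsE //.
  by apply/card_gt0P; exists s0.
by rewrite -PoszM nbrsE // -[in #|V|](cardsC S) PoszD addrAC subrr add0r PoszM.
Qed.
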